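(* Let $G$ be a finite undirected graph (possibly with loops and multiple edges) with nonempty vertex set $V$ and edge set $E$, and let $b\in\mathbb{R}^V$ be nonzero with all entries nonnegative. Let $H$ be a spanning subgraph of $G$. Then the following are equivalent: (i) $H$ is a graph of $\mathcal{P}(G,b)$, i.e. $H\in\mathcal{G}(G,b)$; (ii) $H$ is the graph of a subset of $\mathcal{P}(G,b)$; (iii) $H$ is the graph of an element of $\mathcal{P}(G,b)$, or $H$ has no edges; (iv) $H$ is the graph of a face of $\mathcal{P}(G,b)$; (v) $H$ is a union of graphs of vertices of $\mathcal{P}(G,b)$; (vi) $H$ is the union of the graphs of all vertices of $\mathcal{P}(G,b)$ whose graph is contained in $H$.
   Context: $\delta_G(v)$ denotes the set of edges of $G$ incident with $v$; a loop at $v$ appears once in $\delta_G(v)$. $\mathcal{P}(G,b)=\{x\in\mathbb{R}^E \mid x_e\ge 0 \text{ for each } e\in E,\ \sum_{e\in\delta_G(v)}x_e=b_v \text{ for each } v\in V\}$ (a polytope; empty when $E=\emptyset$, since $b\ne0$). The faces of a polytope include $\emptyset$ and the polytope itself. A spanning subgraph of $G$ is a subgraph with vertex set $V$. For $X\subset\mathcal{P}(G,b)$, the graph $\mathrm{gr}(X)$ of $X$ is the spanning subgraph of $G$ with edge set $\{e\in E\mid \text{there exists } x\in X\text{ with }x_e>0\}$, and the graph of an element $x$ is $\mathrm{gr}(x)=\mathrm{gr}(\{x\})$. $\mathcal{G}(G,b)=\{\mathrm{gr}(X)\mid X\subset\mathcal{P}(G,b)\}$, whose elements are called the graphs of $\mathcal{P}(G,b)$.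 Union and containment of spanning subgraphs of $G$ mean union and containment of their edge sets; an empty union is the spanning subgraph with no edges. *)

(* Defs.v *)
From HB Require Import structures.
From mathcomp Require Import all_boot all_order all_algebra.
From mathcomp Require Import boolp classical_sets reals.

Set Implicit Arguments.
Unset Strict Implicit.
Unset Printing Implicit Defensive.

Import Order.TTheory GRing.Theory Num.Theory.
Local Open Scope classical_set_scope.
Local Open Scope ring_scope.

(* Finite undirected graphs with loops and multiple edges: [ends e] is the set
   of endpoints of the edge [e], a singleton exactly when [e] is a loop.
   A spanning subgraph of [G] contains every vertex, so it is represented by its
   edge set, of type [set (edge G)]. *)
Record multigraph := Multigraph {
  vert : finType;
  edge : finType;
  ends : edge -> {set vert};
  card_ends : forall e, (0 < #|ends e| <= 2)%N
}.

Definition delta (G : multigraph) (v : vert G) : {set edge G} :=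
  [set e | v \in ends e]%SET.

Definition polytope (R : realType) (G : multigraph) (b : {ffun vert G -> R}) :
    set {ffun edge G -> R} :=
  [set x | (forall e, 0 <= x e) /\
           (forall v, \sum_(e in delta v) x e = b v)].

Definition dot (R : realType) (I : finType) (c x : {ffun I -> R}) : R :=
  \sum_i c i * x i.

(* Taking [c = 0] yields [P] itself ([d = 0]) and the empty face ([d = 1]). *)
Definition is_face (R : realType) (I : finType) (P F : set {ffun I -> R}) :
    Prop :=
  exists (c : {ffun I -> R}) (d : R),
    (forall x, P x -> dot c x <= d) /\ F = [set x | P x /\ dot c x = d].

(* The points [x] such that [{x}] is a (zero-dimensional) face. *)
Definition vertices (R : realType) (I : finType) (P : set {ffun I -> R}) :
    set {ffun I -> R} :=
  [set x | is_face P [set x]].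

Definition gr (R : realType) (G : multigraph) (X : set {ffun edge G -> R}) :
    set (edge G) :=
  [set e | exists2 x, X x & 0 < x e].

Definition graphs (R : realType) (G : multigraph) (b : {ffun vert G -> R}) :
    set (set (edge G)) :=
  [set gr X | X in [set X | X `<=` polytope b]].

(* Main.v *)
Require Import Defs.
From HB Require Import structures.
From mathcomp Require Import all_boot all_order all_algebra.
From mathcomp Require Import boolp classical_sets reals.

(* Averaging suitable points of X, one for each edge, gives a single point with
   the same graph as X, and the points of P(G,b) whose graph lies in H form a
   face.  Moreover, if x is in P(G,b) and x_e > 0, there is a vertex y with
   gr(y) contained in gr(x) and y_e > 0: if x is the only point of the face cut
   out by gr(x), it is a vertex; otherwise x can be moved inside that face, in a
   direction that does not decrease x_e, until some coordinate vanishes, and one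
   concludes by induction on the size of the support.  The direction has a
   negative coordinate because it sums to 0 around each vertex. *)

Set Implicit Arguments.
Unset Strict Implicit.
Unset Printing Implicit Defensive.

Import Order.TTheory GRing.Theory Num.Theory.
Local Open Scope classical_set_scope.
Local Open Scope ring_scope.

Section GraphsOfPolytope.
Variables (R : realType) (G : multigraph) (b : {ffun vert G -> R}).
Implicit Types (x y z : {ffun edge G -> R}) (X : set {ffun edge G -> R}).
Implicit Types (H : set (edge G)).

Lemma gr1E x : gr [set x] = [set e | 0 < x e].
Proof. by apply/seteqP; split=> e /= => [[y ->]|]; last exists x. Qed.

Lemma gr_bigcup X : gr X = \bigcup_(x in X) gr [set x].
Proof.
by apply/seteqP; split=> e [x Xx] => [xe|]; rewrite ?gr1E; exists x;
  rewrite ?gr1E.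
Qed.

(** The functional with coefficients 0 on [H] and -1 off [H] is nonpositive on the polytope, and it
    takes the value 0 exactly at the points that vanish off [H]. *)
Lemma is_face_gr_sub H :
  is_face (polytope b) [set y | polytope b y /\ gr [set y] `<=` H].
Proof.
pose c : {ffun edge G -> R} := [ffun e => if `[< H e >] then 0 else -1].
have c_le0 y : polytope b y -> forall e, c e * y e <= 0.
  move=> [y_ge0 _] e; rewrite ffunE.
  by case: ifP; rewrite ?mul0r // mulN1r oppr_le0.
exists c, 0; split=> [y Py|].
  by rewrite /dot sumr_le0 // => e _; apply: c_le0.
apply/seteqP; split=> y /= [Py].
  rewrite gr1E => yH; split=> //; rewrite /dot big1 // => e _; rewrite ffunE.
  case: asboolP => [|nHe]; first by rewrite mul0r.
  have [y_ge0 _] := Py; apply/eqP; rewrite mulN1r oppr_eq0.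
  by rewrite eq_le y_ge0 leNgt andbT; apply/negP => /yH.
move/eqP; rewrite -oppr_eq0 /dot -sumrN => /eqP c0; split=> //.
rewrite gr1E => e /= ye; apply: contrapT => nHe.
have /(_ e isT)/eqP := psumr_eq0P
  (fun e _ => etrans (oppr_ge0 _) (c_le0 y Py e)) c0.
by rewrite ffunE asboolF // mulN1r opprK gt_eqF.
Qed.

Lemma is_face_sub (I : finType) (P F : set {ffun I -> R}) :
  is_face P F -> F `<=` P.
Proof. by move=> [c [d [_ ->]]] x []. Qed.

Lemma vertices_sub (I : finType) (P : set {ffun I -> R}) : vertices P `<=` P.
Proof. by move=> x /is_face_sub; apply. Qed.

(** Every edge has an endpoint, and nonnegative terms with sum 0 around that endpoint all vanish. *)
Lemma delta_sum0_exists_lt0 z :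
  (forall v, \sum_(e in delta v) z e = 0) -> z != 0 -> exists e, z e < 0.
Proof.
move=> z0; apply: contra_neqP => /forallNP z_ge0; apply/ffunP => e.
have /card_gt0P[v ve] : (0 < #|ends e|)%N by case/andP: (card_ends e).
rewrite ffunE; apply: (psumr_eq0P _ (z0 v)); last by rewrite inE.
by move=> f _; rewrite leNgt; apply/negP.
Qed.

(** Moving from [x] along [z] preserves the sums around vertices; coordinates that vanish at [x]
    stay 0, and that of [e] does not decrease. *)
Lemma polytope_shrink x z e :
    polytope b x -> (forall v, \sum_(f in delta v) z f = 0) -> z != 0 ->
    (forall f, x f = 0 -> z f = 0) -> 0 <= z e -> 0 < x e ->
  exists y, [/\ polytope b y, gr [set y] `<=` gr [set x], 0 < y e &
                exists2 f, 0 < x f & y f = 0].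
Proof.
move=> [x_ge0 xb] z0 nz zx ze xe.
have [i0 i0lt0] := delta_sum0_exists_lt0 z0 nz.
(* [t] is the largest step that keeps [x + t z] nonnegative; the minimising coordinate [i] reaches 0
   there. *)
case: (@arg_minP _ _ _ i0 (fun i => z i < 0) (fun i => x i / - z i) i0lt0)
  => i zi; move tE: (x i / - z i) => t imin.
have t_ge0 : 0 <= t by rewrite -tE divr_ge0 // oppr_ge0 ltW.
exists [ffun f => x f + t * z f]; split.
- split=> [f|v]; last first.
    under eq_bigr do rewrite ffunE.
    by rewrite big_split /= -mulr_sumr z0 mulr0 addr0.
  rewrite ffunE; have [zf|zf] := leP 0 (z f).
    by rewrite addr_ge0 ?mulr_ge0.
  by rewrite -[z f]opprK mulrN subr_ge0 -ler_pdivlMr ?oppr_gt0 // imin.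
- rewrite !gr1E => f /=; rewrite ffunE; have := x_ge0 f.
  rewrite le_eqVlt => /predU1P[/esym x0|//].
  by rewrite x0 zx // mulr0 addr0 ltxx.
- by rewrite ffunE ltr_wpDr ?mulr_ge0.
- exists i; last by rewrite ffunE -tE invrN mulrN mulNr mulfVK ?subrr // lt_eqF.
  rewrite lt_neqAle x_ge0 andbT eq_sym.
  by apply/eqP => /zx zi0; rewrite zi0 ltxx in zi.
Qed.

Lemma vertex_gr_sub x e :
    polytope b x -> 0 < x e ->
  exists y, [/\ vertices (polytope b) y, gr [set y] `<=` gr [set x] & 0 < y e].
Proof.
have [n] := ubnP #|[pred f | 0 < x f]|.
elim: n x => // n IHn x /ltnSE-le_n Px xe.
pose F := [set y | polytope b y /\ gr [set y] `<=` gr [set x]].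
have Fx : F x by split.
have [F1|/existsNP[y /not_implyP[[Py yx] /eqP ny]]] :=
  pselect (forall y, F y -> y = x).
  exists x; split=> //; rewrite /vertices /=.
  suff <- : F = [set x] by apply: is_face_gr_sub.
  by apply/seteqP; split=> y => [/F1|->].
pose z : {ffun edge G -> R} := y - x.
have zE f : z f = y f - x f by rewrite !ffunE.
have nz : z != 0 by rewrite subr_eq0.
have [[x_ge0 xb] [y_ge0 yb]] := (Px, Py).
have z0 v : \sum_(f in delta v) z f = 0.
  under eq_bigr do rewrite zE.
  by rewrite sumrB xb yb subrr.
have zx f : x f = 0 -> z f = 0.
  move=> xf; rewrite zE xf subr0; apply/eqP.
  rewrite eq_le y_ge0 andbT leNgt; apply/negP => yf.
  by move: yx; rewrite !gr1E => /(_ f yf) /=; rewrite xf ltxx.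
have [w [Pw wx we [f xf wf]]] : exists w, [/\ polytope b w,
    gr [set w] `<=` gr [set x], 0 < w e & exists2 f, 0 < x f & w f = 0].
  (* One of the directions [z] and [- z] does not decrease the coordinate of [e]. *)
  have [ze|ze] := leP 0 (z e); first exact: (polytope_shrink Px z0 nz zx ze xe).
  apply: (@polytope_shrink x (- z)) => // [v||g /zx zg|]; last 1 first.
  - by rewrite ffunE oppr_ge0 ltW.
  - by under eq_bigr do rewrite ffunE; rewrite sumrN z0 oppr0.
  - by rewrite oppr_eq0.
  - by rewrite ffunE zg oppr0.
(* The edge [f] leaves the support, so that of [w] is strictly smaller. *)
have /IHn/(_ Pw we)[u [Vu uw ue]] : (#|[pred f | (0 < w f)%R]| < n)%N.
  apply: leq_trans le_n; apply: proper_card; apply/properP; split.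
    by apply/fintype.subsetP => g; move: wx; rewrite !gr1E !inE => /(_ g).
  by exists f; rewrite !inE ?xf // wf ltxx.
by exists u; split=> //; apply: subset_trans wx.
Qed.

(** An edge of [gr X] supplies a default point of [X] for the edges outside [gr X], and makes the
    number of edges invertible. *)
Lemma gr_average X :
  X `<=` polytope b -> gr X !=set0 ->
  exists x, polytope b x /\ gr X = gr [set x].
Proof.
move=> XP [e0 [x0 Xx0 _]].
have /choice[f fP] e : exists x, X x /\ (gr X e -> 0 < x e).
  have [[x Xx xe]|nXe] := pselect (gr X e); first by exists x.
  by exists x0.
have f_ge0 g e : 0 <= f g e by have [/XP[+ _] _] := fP g; apply.
have n_gt0 : 0 < #|edge G|%:R :> R.
  by rewrite ltr0n; apply/card_gt0P; exists e0.
exists [ffun e => #|edge G|%:R^-1 * \sum_g f g e]; split; first split.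
- by move=> e; rewrite ffunE mulr_ge0 ?invr_ge0 ?sumr_ge0 // ltW.
- move=> v; under eq_bigr do rewrite ffunE.
  rewrite -mulr_sumr exchange_big /= (eq_bigr (fun=> b v)) => [|g _].
    by rewrite sumr_const -[b v *+ _]mulr_natl mulKf ?gt_eqF.
  by have [/XP[_]] := fP g.
(* For [e] in [gr X] the term of index [e] is positive; for other [e] every term is 0. *)
rewrite gr1E; apply/seteqP; split=> e /=; rewrite ffunE => Xe.
  rewrite mulr_gt0 ?invr_gt0 // (bigD1 e) //= ltr_wpDr ?sumr_ge0 //.
  by have [_] := fP e; apply.
apply: contrapT => nXe; move: Xe; rewrite big1 ?mulr0 ?ltxx // => g _.
apply/eqP; rewrite eq_le f_ge0 andbT leNgt; apply/negP => fge; apply: nXe.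
by exists (f g) => //; have [] := fP g.
Qed.

End GraphsOfPolytope.

Theorem theorem32 (R : realType) (G : multigraph) (b : {ffun vert G -> R})
    (V_nonempty : (0 < #|vert G|)%N)
    (b_neq0 : b != 0)
    (b_ge0 : forall v, 0 <= b v)
    (H : set (edge G)) :
  [<-> H \in graphs b;
       exists X : set {ffun edge G -> R}, X `<=` polytope b /\ H = gr X;
       (exists x : {ffun edge G -> R}, polytope b x /\ H = gr [set x]) \/
         H = set0;
       exists F : set {ffun edge G -> R}, is_face (polytope b) F /\ H = gr F;
       exists S : set {ffun edge G -> R},
         S `<=` vertices (polytope b) /\ H = \bigcup_(x in S) gr [set x];
       H = \bigcup_(x in [set y | vertices (polytope b) y /\
                                  gr [set y] `<=` H]) gr [set x] ].
Proof.
tfae.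
- by rewrite inE => -[X XP <-]; exists X.
- move=> [X [XP ->]]; have [->|/set0P X0] := eqVneq (gr X) set0; first by right.
  by left; apply: gr_average.
- move=> [[x [Px ->]]|->].
    (* This face contains [x], and none of its points has a larger support. *)
    exists [set y | polytope b y /\ gr [set y] `<=` gr [set x]].
    split; first exact: is_face_gr_sub.
    apply/seteqP; split=> e; first by move=> [_ -> xe]; exists x => //; split.
    by move=> [y [_ yx] ye]; apply: yx; rewrite gr1E.
  exists set0; split; last by apply/seteqP; split=> e [] // x [].
  (* The empty graph comes from the empty face, cut out by the unattained equation 0 = 1. *)
  exists 0, 1; have dot0 x : dot 0 x = 0 :> R.
    by rewrite /dot big1 // => e _; rewrite ffunE mul0r.
  split=> [x _|]; first by rewrite dot0 ler01.
  apply/seteqP; split=> x //= [_ /eqP].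
  by rewrite dot0 eq_sym oner_eq0.
- move=> [F [/is_face_sub FP ->]].
  (* These vertices need not lie in [F]; their graphs only have to stay inside [gr F] and cover
     it. *)
  exists [set y | vertices (polytope b) y /\ gr [set y] `<=` gr F].
  split=> [y []//|]; apply/seteqP; split=> e; last first.
    by move=> [y [_ yF] /yF].
  move=> [x Fx xe]; have [y [Vy yx ye]] := vertex_gr_sub (FP x Fx) xe.
  exists y; last by rewrite gr1E.
  by split=> // f /yx; rewrite gr1E => xf; exists x.
- move=> [S [SV HS]]; apply/seteqP; split=> e; last by move=> [y [_ yH] /yH].
  rewrite {1}HS => -[x Sx xe]; exists x => //; split; first exact: SV.
  by rewrite HS => f xf; exists x.
(* The family of vertices is itself a subset of the polytope with graph [H]. *)
- move=> HE; rewrite inE HE -gr_bigcup; eexists=> //.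
  by move=> y [/vertices_sub].
Qed.
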